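(* The flow algorithm (described in the context, with input $d:E\to\mathbb{Z}$) solves both Flow($d$) and the dual problem DualFlow($d$). Its complexity is $O(Bn^2)$, where $B=\frac12\sum_{v\in V}|b^d_v|$ is an upper bound on the number of iterations, and $O(n^2)$ is the complexity of Dijkstra's algorithm for solving the shortest path problem with nonnegative costs in a graph with $n$ vertices.
   Context: Let $s,N\in\mathbb{N}$ and let $\epsilon_\ell$, $\ell=1,\dots,s$, be the standard unit vectors of $\mathbb{R}^s$. $G=(V,E)$ is the directed graph with vertex set $V=\{-N-2,\ldots,0\}^s$ and edge set $E=\{(\beta,\beta-\epsilon_\ell):\beta\in\{-N-1,\ldots,0\}^s,\ \ell=1,\ldots,s\}$; $\bar{G}=(V,\bar{E})$ with $\bar{E}=E\cup\{(v,u):(u,v)\in E\}$. Here $n=|V|$ is the number of vertices. For $d:E\to\mathbb{R}$ put $b^d_v=\sum_{u:(v,u)\in E} d_{vu}-\sum_{u:(u,v)\in E} d_{uv}$ for $v\in V$. Flow($d$): minimize $\sum_{(u,v)\in\bar{E}} f_{uv}$ subject to $\sum_{u:(v,u)\in\bar{E}} f_{vu}-\sum_{u:(u,v)\in\bar{E}} f_{uv}=b^d_v$ for all $v\in V$ and $f_{uv}\ge0$ for all $(u,v)\in\bar{E}$. DualFlow($d$): maximize $\sum_{v\in V} b^d_v x_v$ subject to $x_v-x_u\le1$ for all $(u,v)\in\bar{E}$. Residual network $G(f)$ of a flow $f$: it has vertex set $V$, all edges $(u,v)\in\bar{E}$, and backward edges $(u,v)^{-1}$, directed from $v$ to $u$,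 created for those edges $(u,v)\in\bar{E}$ that lie on the shortest paths found in step 2.2 below. The edges $(u,v)\in\bar{E}$ have unlimited capacity $r_{(u,v)}=\infty$; a backward edge $(u,v)^{-1}$ has capacity $r_{(u,v)^{-1}}=f_{uv}$ if $f_{uv}>0$ and $0$ otherwise (an edge of capacity $0$ is not available to paths). Given $\pi:V\to\mathbb{Z}$, the reduced costs are $c^\pi_{(u,v)}=1-\pi(u)+\pi(v)$ for $(u,v)\in\bar{E}$ and $c^\pi_{(u,v)^{-1}}=-1-\pi(v)+\pi(u)$ for backward edges. Sending flow along a backward edge $(u,v)^{-1}$ decreases the flow $f_{uv}$ through $(u,v)$ by the same amount. Flow algorithm (successive shortest path algorithm). Input: a function $d:E\to\mathbb{Z}$. 1. Compute $b^d_v$ for $v\in V$. Set $\epsilon(v):=b^d_v$ for $v\in V$, $\mathcal{E}_+=\{v\in V:\epsilon(v)>0\}$, $\mathcal{E}_-=\{v\in V:\epsilon(v)<0\}$. Initialize $f:=0$, define $G(f)$, and set $\pi(v)=0$ for each $v\in V$. 2. While $\mathcal{E}_+\ne\emptyset$ do: (2.1) choose any $v_+\in\mathcal{E}_+$ and $v_-\in\mathcal{E}_-$; (2.2) by Dijkstra's algorithm in $G(f)$, with the reduced costs as edge lengths, compute the shortest path distances $\delta(v)$ from $v_+$ to each other vertex $v\in V$ and determine the shortest path $P$ from $v_+$ to $v_-$; (2.3) update $\pi:=\pi-\delta$, compute $\gamma:=\min\{\epsilon(v_+),-\epsilon(v_-),\min\{r_e:e\in P\}\}$, augment $f$ by adding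 a flow of value $\gamma$ along $P$, update $G(f)$ and the reduced costs, set $\epsilon(v_+):=\epsilon(v_+)-\gamma$, $\epsilon(v_-):=\epsilon(v_-)+\gamma$, and update $\mathcal{E}_+,\mathcal{E}_-$. Output: optimal flow $f^*$ (the final $f$) and optimal dual variable $x:=-\pi$.
   Formalization: The optimal dual output is x := π, not −π (−π fails already for s=1, N=0, d(0,−1)=1, d(−1,−2)=0); vertices at infinite distance keep their potential, as π−δ is undefined there; the cost bound is O(max(B,1)n²), since B=0 still costs initialization. *)

(* Defs.v *)
From mathcomp Require Import all_boot all_order all_algebra.

Set Implicit Arguments.
Unset Strict Implicit.
Unset Printing Implicit Defensive.

Import Order.TTheory GRing.Theory Num.Theory.
Local Open Scope ring_scope.

(* [m (Some a) k]: some execution of [m] returns [a] after [k] operations;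
   [m None k]: some execution of [m] gets stuck after [k] operations.
   The machine is a unit-cost RAM: one operation is a bounded number of
   integer operations, comparisons and array accesses.  Arrays are finite
   functions. *)

Definition comp (A : Type) : Type := option A -> nat -> Prop.

Section Programs.
Variables A B : Type.

Definition ret (a : A) : comp A := fun o k => o = Some a /\ k = 0%N.
Definition abort : comp A := fun o k => o = None /\ k = 0%N.
Definition either (a b : A) : comp A :=
  fun o k => (o = Some a \/ o = Some b) /\ k = 0%N.
Definition spend (c : nat) : comp unit := fun o k => o = Some tt /\ k = c.

Definition bind (m : comp A) (p : A -> comp B) : comp B := fun o k =>
  (exists a k1 k2, [/\ m (Some a) k1, p a o k2 & k = (k1 + k2)%N])
  \/ (o = None /\ m None k).

Definition ensures (m : comp A) (Q : A -> nat -> Prop) : Prop :=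
  (exists a k, m (Some a) k)
  /\ forall o k, m o k -> exists2 a, o = Some a & Q a k.

End Programs.

Arguments abort {A}.

Notation tick := (spend 1).
Notation "'let*' x := m 'in' p" := (bind m (fun x => p))
  (at level 200, x name, m at level 100, p at level 200,
   format "'[v' 'let*'  x  :=  m  'in' '/' p ']'").

Definition safe (A : Type) (m : comp A) : Prop := ensures m (fun _ _ => True).

Fixpoint foreach (T S : Type) (xs : seq T) (body : T -> S -> comp S) (x : S) :
    comp S :=
  if xs is t :: xs' then
    let* y := body t x in foreach xs' body y
  else ret x.

Definition upd (I : finType) (X : Type) (a : {ffun I -> X}) (i : I) (x : X) :
  {ffun I -> X} := [ffun j => if j == i then x else a j].

Definition new_array (I : finType) (X : Type) (x : X) : comp {ffun I -> X} :=
  let* _ := spend #|I| in ret [ffun=> x].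

Arguments new_array I {X} x.

Definition choose_in (I : finType) (D : {set I}) : comp I := fun o k =>
  (if o is Some i then i \in D else D == set0) /\ k = #|I|.

(* The arcs [A] form a directed multigraph, because a residual network may have
   an edge and a backward edge with the same ends; only the arcs satisfying
   [avail] may be used.  The distance [None] is infinity. *)

Section ShortestPath.
Variables (V A : finType) (src tgt : A -> V) (avail : pred A) (len : A -> int).

Fixpoint walk (u : V) (p : seq A) (v : V) : bool :=
  if p is e :: p' then [&& avail e, src e == u & walk (tgt e) p' v]
  else u == v.

Definition walk_len (p : seq A) : int := \sum_(e <- p) len e.

Definition shortest (u : V) (p : seq A) (v : V) : Prop :=
  walk u p v /\ forall q, walk u q v -> walk_len p <= walk_len q.

Definition is_distance (u v : V) (l : option int) : Prop :=
  if l is Some x then exists2 p, shortest u p v & walk_len p = x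
  else forall p, ~~ walk u p v.

Definition dist_lt (x y : option int) : bool :=
  match x, y with
  | Some a, Some b => a < b
  | Some _, None => true
  | None, _ => false
  end.

Record dstate := DState {
  dist : {ffun V -> option int};
  pred_arc : {ffun V -> option A};
  queued : {ffun V -> bool}
}.

Definition find_min (st : dstate) : comp V :=
  let* best := foreach (enum V) (fun v best =>
      let* _ := tick in
      if ~~ queued st v then ret best else
      if best is Some w then
        if dist_lt (dist st v) (dist st w) then ret (Some v)
        else if dist_lt (dist st w) (dist st v) then ret best
        else either (Some v) best
      else ret (Some v)) None in
  if best is Some u then ret u else abort.

Definition relax (l : int) (e : A) (st : dstate) : comp dstate :=
  let* _ := tick in
  if avail e && dist_lt (Some (l + len e)) (dist st (tgt e)) then
    ret (DState (upd (dist st) (tgt e) (Some (l + len e)))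
                (upd (pred_arc st) (tgt e) (Some e))
                (queued st))
  else ret st.

Definition dijkstra_round (st : dstate) : comp dstate :=
  let* u := find_min st in
  let st' := DState (dist st) (pred_arc st) (upd (queued st) u false) in
  if dist st u is Some l then
    foreach (enum [pred e | src e == u]) (relax l) st'
  else ret st'.

Fixpoint trace (pr : {ffun V -> option A}) (r : V) (fuel : nat) (w : V)
    (p : seq A) : comp (seq A) :=
  if w == r then ret p else
  if fuel is fuel'.+1 then
    if pr w is Some e then
      let* _ := tick in trace pr r fuel' (src e) (e :: p)
    else abort
  else abort.

(* Stuck, in [trace], when [t] cannot be reached from [r]. *)
Definition dijkstra (r t : V) : comp ({ffun V -> option int} * seq A) :=
  let* d0 := new_array V None in
  let* p0 := new_array V None in
  let* q0 := new_array V true in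
  let* st := foreach (enum V) (fun _ st => dijkstra_round st)
               (DState (upd d0 r (Some 0)) p0 q0) in
  let* p := trace (pred_arc st) r #|V| t [::] in
  ret (dist st, p).

End ShortestPath.

(* The vertex of {-N-2, ..., 0}^s with coordinates - v j. *)
Definition vertex (s N : nat) : finType := {ffun 'I_s -> 'I_(N.+3)}.

Section Graph.
Variables s N : nat.
Local Notation V := (vertex s N).

Definition coord (v : V) : 'rV[int]_s := \row_j - (v j)%:Z.

Definition is_edge (e : V * V) : bool :=
  [forall j, - (N.+1)%:Z <= coord e.1 0 j]
  && [exists l, coord e.2 == coord e.1 - delta_mx 0 l].

Definition edge : finType := {e : V * V | is_edge e}.
Definition arc : finType := {e : V * V | is_edge e || is_edge (e.2, e.1)}.

Definition esrc (e : edge) : V := (val e).1.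
Definition etgt (e : edge) : V := (val e).2.
Definition asrc (a : arc) : V := (val a).1.
Definition atgt (a : arc) : V := (val a).2.

Definition imbalance (R : zmodType) (d : edge -> R) (v : V) : R :=
  \sum_(e | esrc e == v) d e - \sum_(e | etgt e == v) d e.

Section LinearPrograms.
Variables (R : realFieldType) (d : edge -> R).

Definition flow_feasible (f : arc -> R) : Prop :=
  (forall v, \sum_(a | asrc a == v) f a - \sum_(a | atgt a == v) f a
             = imbalance d v)
  /\ forall a, 0 <= f a.

Definition flow_cost (f : arc -> R) : R := \sum_a f a.

Definition solves_flow (f : arc -> R) : Prop :=
  flow_feasible f
  /\ forall g, flow_feasible g -> flow_cost f <= flow_cost g.

Definition dual_feasible (x : V -> R) : Prop :=
  forall a, x (atgt a) - x (asrc a) <= 1.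

Definition dual_value (x : V -> R) : R := \sum_v imbalance d v * x v.

Definition solves_dual (x : V -> R) : Prop :=
  dual_feasible x
  /\ forall y, dual_feasible y -> dual_value y <= dual_value x.

Definition iteration_bound : R := 2^-1 * \sum_v `|imbalance d v|.

End LinearPrograms.

(* [created] marks the arcs whose backward arc has been created. *)
Record state := State {
  eps : {ffun V -> int};
  flow : {ffun arc -> int};
  created : {ffun arc -> bool};
  pot : {ffun V -> int}
}.

Definition E_plus (st : state) : {set V} := [set v | 0 < eps st v].
Definition E_minus (st : state) : {set V} := [set v | eps st v < 0].

(* [inl a] is the arc a itself, [inr a] its backward arc. *)
Definition rarc : finType := (arc + arc)%type.

Definition rsrc (e : rarc) : V :=
  match e with inl a => asrc a | inr a => atgt a end.
Definition rtgt (e : rarc) : V :=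
  match e with inl a => atgt a | inr a => asrc a end.

(* [None] is an unlimited capacity. *)
Definition capacity (f : arc -> int) (e : rarc) : option int :=
  match e with
  | inl _ => None
  | inr a => Some (if 0 < f a then f a else 0)
  end.

Definition available (st : state) (e : rarc) : bool :=
  match e with inl _ => true | inr a => created st a end
  && (if capacity (flow st) e is Some r then 0 < r else true).

Definition reduced_cost (pi : V -> int) (e : rarc) : int :=
  match e with
  | inl a => 1 - pi (asrc a) + pi (atgt a)
  | inr a => -1 - pi (atgt a) + pi (asrc a)
  end.

Definition initialize (d : edge -> int) : comp state :=
  let* b0 := new_array V 0 in
  let* b := foreach (enum edge) (fun e b =>
      let* _ := tick in
      let b' := upd b (esrc e) (b (esrc e) + d e) in
      ret (upd b' (etgt e) (b' (etgt e) - d e))) b0 in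
  let* f := new_array arc 0 in
  let* cr := new_array arc false in
  let* pi := new_array V 0 in
  ret (State b f cr pi).

Definition loop_test (st : state) : comp bool :=
  let* _ := spend #|V| in ret (E_plus st != set0).

(* Some vertices have no incident edge; a vertex at infinite distance keeps its
   potential. *)
Definition update_pot (delta : {ffun V -> option int}) (pi : {ffun V -> int}) :
    comp {ffun V -> int} :=
  foreach (enum V) (fun v pi =>
    let* _ := tick in ret (upd pi v (pi v - odflt 0 (delta v)))) pi.

Definition bottleneck (f : arc -> int) (p : seq rarc) (g : int) : comp int :=
  foreach p (fun e g =>
    let* _ := tick in
    ret (if capacity f e is Some r then Num.min g r else g)) g.

Definition augment (g : int) (p : seq rarc)
    (fc : {ffun arc -> int} * {ffun arc -> bool}) :
    comp ({ffun arc -> int} * {ffun arc -> bool}) :=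
  foreach p (fun e fc =>
    let* _ := tick in
    ret (match e with
         | inl a => (upd fc.1 a (fc.1 a + g), upd fc.2 a true)
         | inr a => (upd fc.1 a (fc.1 a - g), fc.2)
         end)) fc.

Definition iteration (st : state) : comp state :=
  let* vp := choose_in (E_plus st) in
  let* vm := choose_in (E_minus st) in
  let* res := dijkstra rsrc rtgt (available st) (reduced_cost (pot st)) vp vm in
  let: (delta, p) := res in
  let* pi := update_pot delta (pot st) in
  let* g := bottleneck (flow st) p (Num.min (eps st vp) (- eps st vm)) in
  let* fc := augment g p (flow st, created st) in
  let* _ := tick in
  let eps' := upd (eps st) vp (eps st vp - g) in
  ret (State (upd eps' vm (eps' vm + g)) fc.1 fc.2 pi).

(* [loop_head d i st k]: on input d, an execution can be in state st, about to
   test the loop condition, after i iterations and k operations. *)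
Inductive loop_head (d : edge -> int) : nat -> state -> nat -> Prop :=
| Loop_start st k : initialize d (Some st) k -> loop_head d 0 st k
| Loop_next i st k k1 st' k2 :
    loop_head d i st k -> loop_test st (Some true) k1 ->
    iteration st (Some st') k2 -> loop_head d i.+1 st' (k + k1 + k2).

Definition finishes (d : edge -> int) (i : nat) (st : state) (k : nat) : Prop :=
  exists k0 k1, [/\ loop_head d i st k0, loop_test st (Some false) k1
                  & k = (k0 + k1)%N].

Section Output.
Variables (R : realFieldType) (st : state).

Definition out_flow (a : arc) : R := (flow st a)%:~R.

(* The sign: for a flow f with outflow minus inflow equal to b, and reduced
   costs 1 - pi u + pi v vanishing where f > 0, the sum of b v * pi v is the
   cost of f; so pi is the maximizer of the dual objective and - pi, which is
   feasible as well, its minimizer. *)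
Definition out_dual (v : V) : R := (pot st v)%:~R.

End Output.

End Graph.

(* Main.v *)
(* Dijkstra's algorithm: settled vertices are listed in extraction order, and the
   predecessor arc of a vertex starts at a vertex extracted strictly earlier;
   so predecessor chains end at the root, even with arcs of length 0.

   Flow algorithm: along a shortest path the new reduced costs are 0, and
   elsewhere they stay nonnegative, so every arc carrying flow has reduced cost
   0 and the potential satisfies complementary slackness.  Each iteration
   decreases the sum of the |eps v|, initially 2B, by at least 2.  A path from
   v_+ to v_- always exists: the vertices with eps v <> 0 are incident to edges,
   and all such vertices are connected to the origin. *)

Require Import Defs.
From mathcomp Require Import all_boot all_order all_algebra zify ring lra.

Set Implicit Arguments.
Unset Strict Implicit.
Unset Printing Implicit Defensive.

Import Order.TTheory GRing.Theory Num.Theory.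
Local Open Scope ring_scope.

(** * Rules for reasoning about [ensures] *)

Lemma ensures_weaken (A : Type) (m : Defs.comp A) (P Q : A -> nat -> Prop) :
  (forall a k, P a k -> Q a k) -> ensures m P -> ensures m Q.
Proof.
by move=> PQ [ex all_m]; split=> // o k /all_m[a -> /PQ]; exists a.
Qed.

Lemma ensures_ret (A : Type) (a : A) (Q : A -> nat -> Prop) :
  Q a 0%N -> ensures (ret a) Q.
Proof. by move=> Qa; split=> [|o k [-> ->]]; [exists a, 0%N | exists a]. Qed.

Lemma ensures_either (A : Type) (a b : A) (Q : A -> nat -> Prop) :
  Q a 0%N -> Q b 0%N -> ensures (either a b) Q.
Proof.
move=> Qa Qb; split=> [|o k [[] -> ->]]; last by exists b.
  by exists a, 0%N; split=> //; left.
by exists a.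
Qed.

Lemma ensures_spend (c : nat) (Q : unit -> nat -> Prop) :
  Q tt c -> ensures (spend c) Q.
Proof. by move=> Qc; split=> [|o k [-> ->]]; [exists tt, c | exists tt]. Qed.

(** A run of [bind] either finishes [m] and continues, or is stuck because [m] is. The premise
    excludes the latter and charges the continuation with the cost already paid by [m]. *)
Lemma ensures_bind (A B : Type) (m : Defs.comp A) (p : A -> Defs.comp B)
    (Q : B -> nat -> Prop) :
  ensures m (fun a k1 => ensures (p a) (fun b k2 => Q b (k1 + k2)%N)) ->
  ensures (bind m p) Q.
Proof.
move=> [[a [k1 mak1]] all_m]; split=> [|o k].
  have [a' [<-] [[b [k2 pbk2]] _]] := all_m _ _ mak1.
  by exists b, (k1 + k2)%N; left; exists a, k1, k2.
case=> [[a'] [k1'] [k2] [ma' pa' ->] | [_ /all_m[//]]].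
by have [_ [<-] [_ all_p]] := all_m _ _ ma'; apply: all_p.
Qed.

(** The invariant depends on the prefix already processed and on the cost so far, so that a loop can
    record both what it has visited and what it has paid. *)
Lemma ensures_foreach (T S : Type) (I : seq T -> S -> nat -> Prop)
    (body : T -> S -> Defs.comp S) (xs : seq T) (x : S) :
  I [::] x 0%N ->
  (forall pre t post y K, xs = pre ++ t :: post -> I pre y K ->
     ensures (body t y) (fun z k => I (rcons pre t) z (K + k)%N)) ->
  ensures (foreach xs body x) (I xs).
Proof.
move=> I0 step.
suff gen ys pre y K : xs = pre ++ ys -> I pre y K ->
    ensures (foreach ys body y) (fun z k => I xs z (K + k)%N).
  exact: gen xs [::] x 0%N erefl I0.
elim: ys pre y K => [|t ys IH] pre y K /= def_xs Iy.
  by apply: ensures_ret; rewrite addn0 def_xs cats0.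
apply: ensures_bind; apply: ensures_weaken (step _ _ _ _ _ def_xs Iy).
move=> z k Iz; have := IH (rcons pre t) z (K + k)%N _ Iz.
rewrite cat_rcons => /(_ def_xs); apply: ensures_weaken => z' k'.
by rewrite addnA.
Qed.

Lemma ensures_new_array (I : finType) (X : Type) (x : X)
    (Q : {ffun I -> X} -> nat -> Prop) :
  Q [ffun=> x] #|I| -> ensures (new_array I x) Q.
Proof.
move=> Qx; apply: ensures_bind; apply: ensures_spend; apply: ensures_ret.
by rewrite addn0.
Qed.

Lemma ensures_choose_in (I : finType) (D : {set I}) (Q : I -> nat -> Prop) :
  D != set0 -> (forall i, i \in D -> Q i #|I|) -> ensures (choose_in D) Q.
Proof.
move=> D_n0 QD; split=> [|[i|] k [Di ->]]; last by rewrite Di in D_n0.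
  by have /set0Pn[i Di] := D_n0; exists i, #|I|.
by exists i => //; apply: QD.
Qed.

(** * Array updates, extended distances and positions in a list *)

Lemma updE (I : finType) (X : Type) (a : {ffun I -> X}) i x j :
  upd a i x j = if j == i then x else a j.
Proof. by rewrite ffunE. Qed.

(** Negating the reversed strict order makes [None] the greatest element, comparable with itself. *)
Definition dist_le (x y : option int) : bool := ~~ dist_lt y x.

Lemma dist_le_refl x : dist_le x x.
Proof. by case: x => //= x; rewrite /dist_le /= ltxx. Qed.

Lemma dist_le_trans y x z : dist_le x y -> dist_le y z -> dist_le x z.
Proof.
case: x y z => [x|] [y|] [z|] //; rewrite /dist_le /= -!leNgt; exact: le_trans.
Qed.

Lemma dist_ltW x y : dist_lt x y -> dist_le x y.
Proof. by case: x y => [x|] [y|] //; rewrite /dist_le /= -leNgt => /ltW. Qed.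

Lemma dist_le_Some x b :
  dist_le x (Some b) -> exists2 a, x = Some a & a <= b.
Proof. by case: x => // a; rewrite /dist_le /= -leNgt; exists a. Qed.

(** The hypothesis puts [x] in [s], so its index is unchanged; the index of [y] cannot drop, even if
    [y] is absent from [s]. *)
Lemma index_rcons_lt (T : eqType) (s : seq T) x y z :
  (index x s < index y s)%N -> (index x (rcons s z) < index y (rcons s z))%N.
Proof.
move=> lt_xy; have xs : x \in s by rewrite -index_mem (leq_trans lt_xy) ?index_size.
rewrite -cats1 !index_cat xs; case: ifP => // _.
by apply: leq_trans (leq_addr _ _); rewrite index_mem.
Qed.

(** * Correctness and cost of Dijkstra's algorithm *)

Section Dijkstra.
Variables (V A : finType) (src tgt : A -> V) (avail : pred A) (len : A -> int).
Variable r : V.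
Hypothesis len_ge0 : forall e, avail e -> 0 <= len e.

Lemma walk_cat u p v q w :
  walk src tgt avail u p v -> walk src tgt avail v q w ->
  walk src tgt avail u (p ++ q) w.
Proof.
elim: p u => [|e p IH] u /=; first by move=> /eqP->.
by case/and3P=> -> -> /IH; apply.
Qed.

Lemma walk_split u p e q w : walk src tgt avail u (p ++ e :: q) w ->
  [/\ walk src tgt avail u p (src e), avail e & walk src tgt avail (tgt e) q w].
Proof.
elim: p u => [|e0 p IH] u /=; first by case/and3P=> -> /eqP->.
by case/and3P=> -> -> /IH[].
Qed.

Lemma walk_len_cat p q : walk_len len (p ++ q) = walk_len len p + walk_len len q.
Proof. exact: big_cat. Qed.

Lemma walk_len_cons e p : walk_len len (e :: p) = len e + walk_len len p.
Proof. exact: big_cons. Qed.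

(* [ord] lists the vertices in the order of their extraction from the queue. *)
Record dinv (ord : seq V) (relaxed : pred A) (st : dstate V A) : Prop := DInv {
  dinv_uniq : uniq ord;
  dinv_queued : forall v, queued st v = (v \notin ord);
  dinv_root : dist st r = Some 0;
  dinv_ge0 : forall v l, dist st v = Some l -> 0 <= l;
  dinv_pred : forall v l, dist st v = Some l -> v != r ->
    exists e l', [/\ pred_arc st v = Some e, avail e & tgt e = v]
      /\ [/\ (index (src e) ord < index v ord)%N, dist st (src e) = Some l'
           & l = l' + len e];
  dinv_src : forall e, relaxed e -> src e \in ord;
  dinv_relaxed : forall e l, avail e -> relaxed e -> dist st (src e) = Some l ->
    dist_le (dist st (tgt e)) (Some (l + len e));
  dinv_settled : forall u v, u \in ord -> v \notin ord ->
    dist_le (dist st u) (dist st v)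
}.

(** The queued vertex [w] prevents the scan from ending in [None] and aborting. Ties may be broken
    either way, since both candidates are then minimal. *)
Lemma find_min_ok (st : dstate V A) w : queued st w ->
  ensures (find_min st) (fun u k =>
    [/\ queued st u, forall v, queued st v -> dist_le (dist st u) (dist st v)
      & k = #|V|]).
Proof.
move=> qw; apply: ensures_bind.
pose I (pre : seq V) (best : option V) K := K = size pre /\
  if best is Some u then queued st u
    /\ forall v, v \in pre -> queued st v -> dist_le (dist st u) (dist st v)
  else forall v, v \in pre -> ~~ queued st v.
apply: (@ensures_weaken _ _ (I (enum V))).
  move=> [u|] k [->]; last by move=> /(_ w); rewrite mem_enum qw => /(_ isT).
  case=> qu min_u; apply: ensures_ret; rewrite addn0 -cardE; split=> // v.
  by apply: min_u; rewrite mem_enum.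
apply: ensures_foreach => // pre v post best K _ [-> Ib].
apply: ensures_bind; apply: ensures_spend.
have sz : (size pre + 1)%N = size (rcons pre v) by rewrite size_rcons addn1.
case: ifPn => [nqv|/negPn qv].
  apply: ensures_ret; split=> //=; case: best Ib => [u [qu Iu]|Ib].
    by split=> // x; rewrite mem_rcons inE => /predU1P[->|/Iu//]; rewrite (negPf nqv).
  by move=> x; rewrite mem_rcons inE => /predU1P[->|/Ib].
case: best Ib => [u [qu Iu]|Ib]; last first.
  apply: ensures_ret; split=> //; split=> // x.
  by rewrite mem_rcons inE => /predU1P[->|/Ib/negPf->//]; rewrite dist_le_refl.
have keep_u : dist_le (dist st u) (dist st v) ->
    I (rcons pre v) (Some u) (size pre + (1 + 0))%N.
  by split=> //; split=> // x; rewrite mem_rcons inE => /predU1P[->|/Iu].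
have take_v : dist_le (dist st v) (dist st u) ->
    I (rcons pre v) (Some v) (size pre + (1 + 0))%N.
  move=> le_vu; split=> //; split=> // x; rewrite mem_rcons inE.
  case/predU1P=> [->|x_pre qx]; first by rewrite dist_le_refl.
  exact: dist_le_trans le_vu (Iu _ x_pre qx).
case: ifPn => [/dist_ltW/take_v|le_uv]; first exact: ensures_ret.
case: ifPn => [/dist_ltW/keep_u|le_vu]; first exact: ensures_ret.
by apply: ensures_either; [apply: take_v | apply: keep_u].
Qed.

(** Extracted vertices have distance at most [l] and available arcs have nonnegative length, so a
    strict improvement can only hit a vertex still in the queue. *)
Lemma relax_ok ord u l (relaxed : pred A) (st : dstate V A) e :
  dinv ord relaxed st -> u \in ord -> src e = u -> dist st u = Some l ->
  (forall w, w \in ord -> dist_le (dist st w) (Some l)) ->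
  ensures (relax tgt avail len l e st) (fun st' k =>
    [/\ k = 1%N, dinv ord (predU1 e relaxed) st', dist st' u = Some l
      & forall w, w \in ord -> dist_le (dist st' w) (Some l)]).
Proof.
move=> inv u_ord src_e dist_u max_u; apply: ensures_bind; apply: ensures_spend.
have new_src e0 : predU1 e relaxed e0 -> src e0 \in ord.
  by case/predU1P=> [->|/(dinv_src inv)//]; rewrite src_e.
case: ifPn => [/andP[av_e lt_e]|not_better]; last first.
  apply: ensures_ret; split=> //; case: inv => *; split=> // e0 l0 av0 /predU1P[]; last by auto.
  move=> eq0; move: not_better; rewrite eq0 in av0 *.
  by rewrite av0 src_e dist_u => not_better [<-].
have l_ge0 := dinv_ge0 inv dist_u; have e_ge0 := len_ge0 av_e.
have tgt_notin : tgt e \notin ord.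
  apply/negP => /max_u/dist_le_Some[b def_b le_bl].
  by move: lt_e; rewrite def_b /=; lia.
have upd_ord w : w \in ord -> upd (dist st) (tgt e) (Some (l + len e)) w = dist st w.
  by move=> w_ord; rewrite updE; case: eqP tgt_notin => // <-; rewrite w_ord.
have upd_le w : dist_le (upd (dist st) (tgt e) (Some (l + len e)) w) (dist st w).
  by rewrite updE; case: eqP => [->|_]; rewrite ?dist_le_refl ?dist_ltW.
(* The root has distance 0, which a nonnegative candidate cannot improve. *)
have tgt_r : tgt e != r.
  apply/eqP=> tgt_r; move: lt_e; rewrite tgt_r (dinv_root inv) /=; lia.
apply: ensures_ret; split=> //=; last 2 first.
- by rewrite upd_ord.
- by move=> w w_ord; rewrite upd_ord ?max_u.
split=> //=; try by case: inv.
- by rewrite updE eq_sym (negPf tgt_r) (dinv_root inv).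
- move=> v l0; rewrite updE; case: eqP => [_ [<-]|_ /(dinv_ge0 inv)//]; lia.
- move=> v l0; rewrite !updE; case: eqP => [-> [<-] _|ne_v dist_v v_r].
    exists e, l; split=> //; rewrite src_e upd_ord ?dist_u //; split=> //.
    (* A vertex outside [ord] has index [size ord], above that of every extracted vertex. *)
    by rewrite (memNindex tgt_notin) index_mem.
  have [e0 [l' [[pr0 av0 tgt0] [lt0 dist0 ->]]]] := dinv_pred inv dist_v v_r.
  exists e0, l'; split=> //; split=> //; rewrite upd_ord // -index_mem.
  exact: leq_trans lt0 (index_size _ _).
- move=> e0 l0 av0 rel0; rewrite upd_ord ?new_src // => dist0.
  case/predU1P: rel0 => [eq0|/(dinv_relaxed inv av0)/(_ dist0)]; last first.
    exact: dist_le_trans.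
  move: dist0; rewrite eq0 src_e dist_u => -[<-].
  by rewrite updE eqxx dist_le_refl.
- move=> x v x_ord v_ord; rewrite upd_ord // updE; case: eqP => [_|_].
    have [b -> le_bl] := dist_le_Some (max_u _ x_ord).
    by rewrite /dist_le /= -leNgt; lia.
  exact: dinv_settled inv _ _ x_ord v_ord.
Qed.

Lemma dinv_eq_relaxed ord (P Q : pred A) (st : dstate V A) :
  P =1 Q -> dinv ord P st -> dinv ord Q st.
Proof.
by move=> eqPQ [*]; split=> // e; rewrite -eqPQ; auto.
Qed.

Lemma dijkstra_round_ok ord (st : dstate V A) :
  dinv ord [pred e | src e \in ord] st -> (size ord < #|V|)%N ->
  ensures (dijkstra_round src tgt avail len st) (fun st' k => exists u,
    [/\ u \notin ord, dinv (rcons ord u) [pred e | src e \in rcons ord u] st'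
      & (k <= #|V| + #|[pred e | src e == u]|)%N]).
Proof.
move=> inv lt_ord.
have [w qw] : exists w, queued st w.
  apply/existsP; apply: contraLR lt_ord; rewrite negb_exists => /forallP all_ord.
  rewrite -leqNgt; apply: leq_trans (card_size ord); apply/subset_leq_card.
  by apply/subsetP=> v _; have := all_ord v; rewrite (dinv_queued inv) negbK.
apply: ensures_bind; apply: ensures_weaken (find_min_ok qw) => u _ [qu min_u ->].
have u_notin : u \notin ord by rewrite -(dinv_queued inv).
pose st0 := DState (dist st) (pred_arc st) (upd (queued st) u false).
(* Here [u] is extracted but its outgoing arcs are not yet relaxed; the choice of a minimal [u]
   gives the settled clause. *)
have inv0 : dinv (rcons ord u) [pred e | src e \in ord] st0.
  case: inv => Iuniq Iq Ir I0 Ipred Isrc Irel Iset; split=> //=.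
  - by rewrite rcons_uniq u_notin.
  - by move=> v; rewrite updE mem_rcons inE negb_or Iq; case: eqP.
  - move=> v l dist_v v_r; have [e [l' [? [? ? ?]]]] := Ipred v l dist_v v_r.
    by exists e, l'; split=> //; split=> //; apply: index_rcons_lt.
  - by move=> e src_e; rewrite mem_rcons inE src_e orbT.
  - move=> x v; rewrite !mem_rcons !inE negb_or => x_ord /andP[v_u v_ord].
    by case/predU1P: x_ord => [->|/Iset->//]; rewrite min_u ?Iq.
case def_l: (dist st u) => [l|]; last first.
  (* At infinite distance, the relaxation clause for the arcs leaving [u] is vacuous. *)
  apply: ensures_ret; exists u; split=> //; last by rewrite addn0 leq_addr.
  case: inv0 => Iuniq Iq Ir I0 Ipred Isrc Irel Iset; split=> // e l av_e /=.
  rewrite mem_rcons inE => /predU1P[->|src_e]; first by rewrite def_l.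
  exact: Irel.
pose I (pre : seq A) st' K :=
  [/\ dinv (rcons ord u) [pred e | (src e \in ord) || (e \in pre)] st',
      dist st' u = Some l,
      forall w, w \in rcons ord u -> dist_le (dist st' w) (Some l)
    & K = size pre].
apply: (@ensures_weaken _ _ (I (enum [pred e | src e == u]))).
  move=> st' k [inv' _ _ ->]; exists u; split=> //; last by rewrite -cardE.
  apply: dinv_eq_relaxed inv' => e /=.
  by rewrite mem_enum mem_rcons !inE orbC.
apply: ensures_foreach => [|pre e post st' K eq_enum [inv' dist_u max_u ->]].
  split=> //; first by apply: dinv_eq_relaxed inv0 => e /=; rewrite orbF.
  move=> x; rewrite -def_l mem_rcons inE => /predU1P[->|x_ord].
    exact: dist_le_refl.
  exact: dinv_settled inv _ _ x_ord u_notin.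
have /eqP src_e : src e == u.
  have : e \in enum [pred e | src e == u] by rewrite eq_enum mem_cat mem_head orbT.
  by rewrite mem_enum.
have u_ord : u \in rcons ord u by rewrite mem_rcons mem_head.
apply: ensures_weaken (relax_ok inv' u_ord src_e dist_u max_u).
move=> st'' k [-> inv'' dist_u'' max'']; split; rewrite ?size_rcons ?addn1 //.
by apply: dinv_eq_relaxed inv'' => e'; rewrite /= mem_rcons inE orbCA.
Qed.

(** Each round extracts a new vertex, so [#|V|] rounds extract them all. Every round scans [#|V|]
    vertices, while each arc is paid for only in the round of its source. *)
Lemma dijkstra_rounds_ok (st0 : dstate V A) :
  dinv [::] [pred e | src e \in [::]] st0 ->
  ensures (foreach (enum V) (fun _ st => dijkstra_round src tgt avail len st) st0)
    (fun st k => exists ord : seq V, [/\ forall v, v \in ord,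
       dinv ord [pred e | src e \in ord] st & (k <= #|V| * #|V| + #|A|)%N]).
Proof.
move=> inv0; pose I (pre : seq V) st K := exists ord : seq V,
  [/\ size ord = size pre, dinv ord [pred e | src e \in ord] st
    & (K <= size pre * #|V| + #|[pred e | src e \in ord]|)%N].
apply: (@ensures_weaken _ _ (I (enum V))).
  move=> st k [ord [sz_ord inv le_k]]; exists ord; split=> //; last first.
    by apply: leq_trans le_k _; rewrite -cardE leq_add2l max_card.
  move=> v; have /subset_cardP : #|ord| = #|V|.
    by rewrite (card_uniqP (dinv_uniq inv)) sz_ord -cardE.
  by move/(_ (subset_predT _)) => ->.
apply: ensures_foreach => [|pre v post st K eq_enum]; first by exists [::].
case=> ord [sz_ord inv le_K].
have lt_ord : (size ord < #|V|)%N.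
  by rewrite cardE eq_enum size_cat sz_ord /= addnS ltnS leq_addr.
apply: ensures_weaken (dijkstra_round_ok inv lt_ord) => st' k [u [u_ord inv' le_k]].
exists (rcons ord u); split; rewrite ?size_rcons ?sz_ord //.
(* The arcs leaving [u] are disjoint from those already counted, because [u] is new. *)
have -> : #|[pred e | src e \in rcons ord u]|
    = (#|[pred e | src e \in ord]| + #|[pred e | src e == u]|)%N.
  rewrite -cardUI [X in (_ + X)%N]eq_card0 ?addn0.
    by apply: eq_card => e; rewrite !inE mem_rcons inE orbC.
  by move=> e; rewrite !inE; case: eqP => [->|_]; rewrite ?andbF ?(negPf u_ord).
by rewrite mulSn; lia.
Qed.

(** * Distances and shortest paths read off the final state *)

Section Final.
Variables (ord : seq V) (st : dstate V A).
Hypothesis inv : dinv ord [pred e | src e \in ord] st.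
Hypothesis ord_full : forall v, v \in ord.

(** With all vertices extracted, every available arc has been relaxed, so [dist] satisfies the
    triangle inequality on each arc of the walk. *)
Lemma dist_walk u p v l : dist st u = Some l -> walk src tgt avail u p v ->
  exists2 l', dist st v = Some l' & l' <= l + walk_len len p.
Proof.
rewrite /walk_len; elim: p u l => [|e p IH] u l dist_u /=.
  by move/eqP <-; exists l => //; rewrite big_nil addr0.
case/and3P=> av_e /eqP src_e; rewrite big_cons addrA.
have /dist_le_Some[l1 dist1 le1] :=
  dinv_relaxed inv av_e (ord_full _) (etrans (congr1 _ src_e) dist_u).
move=> /(IH _ _ dist1)[l' -> le']; exists l' => //.
by apply: le_trans le' _; rewrite lerD2r.
Qed.

(** A predecessor arc strictly lowers the index in [ord], so the index of [w] bounds the number of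
    remaining steps. The arcs already collected end after [w] in [ord], hence differ from the next
    arc, which ends at [w]. *)
Lemma trace_ok (t : V) fuel w p l : dist st w = Some l ->
  walk src tgt avail w p t -> uniq p ->
  (forall e, e \in p -> (index w ord < index (tgt e) ord)%N) ->
  (index w ord <= fuel)%N ->
  ensures (trace src (pred_arc st) r fuel w p) (fun q k =>
    [/\ walk src tgt avail r q t, walk_len len q = l + walk_len len p, uniq q,
        size q = (size p + k)%N & (k <= fuel)%N]).
Proof.
elim: fuel w p l => [|fuel IH] w p l dist_w walk_p uniq_p lt_p le_fuel /=;
  (case: eqP => [w_r|/eqP w_r]; [apply: ensures_ret|]).
- move: dist_w; rewrite w_r (dinv_root inv) => -[<-].
  by rewrite add0r addn0 -w_r.
(* Without fuel, [w] has index 0, and no vertex can precede it. *)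
- have [e [l' [_ [lt_e _ _]]]] := dinv_pred inv dist_w w_r.
  by move: le_fuel; rewrite leqn0 => /eqP le0; rewrite le0 in lt_e.
- move: dist_w; rewrite w_r (dinv_root inv) => -[<-].
  by rewrite add0r addn0 -w_r.
have [e [l' [[-> av_e tgt_e] [lt_e dist_e ->]]]] := dinv_pred inv dist_w w_r.
apply: ensures_bind; apply: ensures_spend.
have lt_ep e0 : e0 \in e :: p -> (index (src e) ord < index (tgt e0) ord)%N.
  by rewrite inE => /predU1P[->|/lt_p]; rewrite ?tgt_e //; apply: ltn_trans.
have e_notin : e \notin p by apply/negP => /lt_p; rewrite tgt_e ltnn.
have le_e : (index (src e) ord <= fuel)%N by rewrite -ltnS (leq_trans lt_e).
apply: ensures_weaken (IH (src e) (e :: p) l' dist_e _ _ lt_ep le_e) => /=.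
- move=> q k [walk_q -> uniq_q -> le_k]; split=> //; last by rewrite addnA addn1.
  by rewrite walk_len_cons addrA.
- by rewrite av_e eqxx tgt_e.
- by rewrite e_notin.
Qed.

Lemma trace_shortest t l : dist st t = Some l ->
  ensures (trace src (pred_arc st) r #|V| t [::]) (fun q k =>
    [/\ shortest src tgt avail len r q t, walk_len len q = l, uniq q,
        size q = k & (k <= #|V|)%N]).
Proof.
move=> dist_t; have le_t : (index t ord <= #|V|)%N.
  rewrite (leq_trans (index_size _ _)) // -(card_uniqP (dinv_uniq inv)).
  exact: max_card.
apply: ensures_weaken (trace_ok (p := [::]) dist_t (eqxx t) isT _ le_t) => // q k.
rewrite /walk_len big_nil addr0 => -[walk_q len_q uniq_q sz_q le_k]; split=> //.
split=> // q' walk_q'; rewrite /walk_len len_q.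
have [l' ] := dist_walk (dinv_root inv) walk_q'.
by rewrite dist_t add0r => -[<-].
Qed.

(** For a finite distance, the required shortest path is the result of an execution of [trace],
    which [ensures] asserts to exist. *)
Lemma dist_is_distance v : is_distance src tgt avail len r v (dist st v).
Proof.
case def_v: (dist st v) => [l|] /=.
  have [[q [k m_q]] all_q] := trace_shortest def_v.
  by have [_ [<-] [short_q len_q _ _ _]] := all_q _ _ m_q; exists q.
by move=> p; apply/negP => /(dist_walk (dinv_root inv))[l]; rewrite def_v.
Qed.

End Final.

Lemma dijkstra_ok t : (exists p, walk src tgt avail r p t) ->
  ensures (dijkstra src tgt avail len r t) (fun res k =>
    [/\ forall v, is_distance src tgt avail len r v (res.1 v),
        shortest src tgt avail len r res.2 t, uniq res.2, (size res.2 <= #|V|)%N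
      & (k <= 4 * #|V| + #|V| ^ 2 + #|A|)%N]).
Proof.
case=> p0 walk_p0.
apply: ensures_bind; apply: ensures_new_array.
apply: ensures_bind; apply: ensures_new_array.
apply: ensures_bind; apply: ensures_new_array.
set st0 := DState _ _ _.
have inv0 : dinv [::] [pred e | src e \in [::]] st0.
  split=> //=; try by [move=> v; rewrite ffunE | rewrite updE eqxx].
    by move=> v l; rewrite !ffunE; case: eqP => // _ [<-].
  by move=> v l; rewrite !ffunE; case: eqP.
apply: ensures_bind; apply: ensures_weaken (dijkstra_rounds_ok inv0) => st k.
case=> ord [full inv le_k].
have [l dist_t _] := dist_walk inv full (dinv_root inv) walk_p0.
apply: ensures_bind; apply: ensures_weaken (trace_shortest inv full dist_t).
move=> q k' [short_q _ uniq_q sz_q le_k']; apply: ensures_ret; split=> //.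
- exact: dist_is_distance inv full.
- by rewrite sz_q.
(* Three array allocations and at most [#|V|] steps of [trace] make up [4 * #|V|]. *)
by rewrite -mulnn; lia.
Qed.

End Dijkstra.

(** * Divergence of a function on the arcs of a graph *)

Section Divergence.
Variables (V A : finType) (src tgt : A -> V).

(** Covers both [imbalance d], taken over the edges, and the outflow minus inflow of a flow, taken
    over the arcs. *)
Definition divergence (R : zmodType) (f : A -> R) (v : V) : R :=
  \sum_(a | src a == v) f a - \sum_(a | tgt a == v) f a.

(** Summation by parts: the arcs are grouped by source in one sum and by target in the other. *)
Lemma sum_divergence (R : pzRingType) (f : A -> R) (x : V -> R) :
  \sum_v divergence f v * x v = \sum_a f a * (x (src a) - x (tgt a)).
Proof.
have part (h : A -> V) :
    \sum_v (\sum_(a | h a == v) f a) * x v = \sum_a f a * x (h a).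
  rewrite [RHS](partition_big h xpredT) //=; apply: eq_bigr => v _.
  by rewrite mulr_suml; apply: eq_bigr => a /eqP->.
under eq_bigr do rewrite mulrBl.
by rewrite sumrB !part -sumrB; apply: eq_bigr => a _; rewrite mulrBr.
Qed.

Lemma sum_divergence_eq0 (R : pzRingType) (f : A -> R) :
  \sum_v divergence f v = 0.
Proof.
transitivity (\sum_v divergence f v * 1); first by under [RHS]eq_bigr do rewrite mulr1.
rewrite (sum_divergence f (fun=> 1)).
by apply: big1 => a _; rewrite subrr mulr0.
Qed.

Lemma divergence_intr (R : pzRingType) (f : A -> int) v :
  divergence (fun a => (f a)%:~R : R) v = (divergence f v)%:~R.
Proof. by rewrite /divergence rmorphB /= !rmorph_sum. Qed.

Lemma sum_upd (P : pred A) (f : {ffun A -> int}) a x :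
  \sum_(i | P i) upd f a (f a + x) i = \sum_(i | P i) f i + x * (P a)%:R.
Proof.
have -> : x * (P a)%:R = \sum_(i | P i) (if i == a then x else 0).
  rewrite -big_mkcondr /=; case Pa: (P a); rewrite ?mulr1 ?mulr0.
    by rewrite (big_pred1 a) // => i /=; case: eqP => [->|]; rewrite ?Pa ?andbF.
  by rewrite big_pred0 // => i; case: eqP => [->|]; rewrite ?Pa ?andbF.
rewrite -big_split /=; apply: eq_bigr => i _; rewrite updE.
by case: eqP => [->//|_]; rewrite addr0.
Qed.

Lemma divergence_upd (f : {ffun A -> int}) a x v :
  divergence (upd f a (f a + x)) v
  = divergence f v + x * ((src a == v)%:R - (tgt a == v)%:R).
Proof. by rewrite /divergence !sum_upd; ring. Qed.

(** Contributions at inner vertices cancel; hence augmenting along a walk changes the divergence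
    only at its ends. *)
Lemma walk_telescope (avail : pred A) u p w v : walk src tgt avail u p w ->
  \sum_(e <- p) ((src e == v)%:R - (tgt e == v)%:R : int)
  = (u == v)%:R - (w == v)%:R.
Proof.
elim: p u => [|e p IH] u /=; first by move/eqP->; rewrite big_nil subrr.
by rewrite big_cons => /and3P[_ /eqP-> /IH->]; ring.
Qed.

End Divergence.

(** * Connectivity of the residual network and the loop invariant *)

Section Residual.
Variables s N : nat.
Local Notation V := (vertex s N).
Local Notation arc := (Defs.arc s N).
Local Notation edge := (edge s N).
Local Notation rarc := (rarc s N).
Implicit Types (d : edge -> int) (st : state s N).

Definition adjacent : rel V := [rel u v | is_edge (u, v) || is_edge (v, u)].

Definition origin : V := [ffun => ord0].

Lemma adjacent_connect_sym : connect_sym adjacent.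
Proof. by apply: sym_connect_sym => u v; rewrite /adjacent /= orbC. Qed.

Lemma arc_between u v : adjacent u v ->
  exists a : arc, asrc a = u /\ atgt a = v.
Proof. by move=> uv; exists (Sub (u, v) uv). Qed.

Lemma arc_adjacent (a : arc) : adjacent (asrc a) (atgt a).
Proof. by have := valP a; rewrite /asrc /atgt; case: (val a). Qed.

Lemma reverse_arc (a : arc) : exists b : arc, asrc b = atgt a /\ atgt b = asrc a.
Proof. by apply: arc_between; have := arc_adjacent a; rewrite /adjacent /= orbC. Qed.

(** The arc set is symmetric, so any residual arc can be traversed back along a forward arc, which
    is always available. *)
Lemma reverse_rarc (e : rarc) : exists b : arc, asrc b = rtgt e /\ atgt b = rsrc e.
Proof. by case: e => a /=; [apply: reverse_arc | exists a]. Qed.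

Lemma connect_walk st u v : connect adjacent u v ->
  exists p, walk (@rsrc s N) (@rtgt s N) (available st) u p v.
Proof.
case/connectP=> p + ->; elim: p u => [|w p IH] u /=; first by exists [::] => /=.
case/andP=> /arc_between[a [<- <-]] /IH[q walk_q].
by exists (inl a :: q); rewrite /= eqxx.
Qed.

Lemma edge_src_le (e : edge) j : (esrc e j <= N.+1)%N.
Proof.
have /andP[/forallP/(_ j) + _] := valP e.
by rewrite mxE lerN2 lez_nat.
Qed.

(** Induction on the sum of the [v j]: lowering a nonzero one by 1 is a step towards the origin and
    stays within the bound [N.+1] required of the source of an edge. *)
Lemma box_connect (v : V) : (forall j, v j <= N.+1)%N -> connect adjacent v origin.
Proof.
have [n] := ubnP (\sum_j v j)%N; elim: n v => // n IH v lt_n box_v.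
have [/existsP[l v_l]|all0] := boolP [exists l, v l != ord0]; last first.
  suff -> : v = origin by apply: connect0.
  apply/ffunP=> j; rewrite ffunE; apply/eqP; apply: contraNT all0 => v_j.
  by apply/existsP; exists j.
have vl_gt0 : (0 < v l)%N by rewrite lt0n.
pose w : V := [ffun j => if j == l then inord (v j).-1 else v j].
have wl : (w l = (v l).-1 :> nat)%N.
  by rewrite ffunE eqxx inordK // (leq_ltn_trans (leq_pred _)).
have wE j : j != l -> w j = v j by rewrite ffunE => /negPf->.
(* Coordinates are the negated entries, so the edge runs from [w] to [v]. *)
have wv : adjacent v w.
  apply/orP; right; apply/andP; split=> /=.
    apply/forallP=> j; rewrite mxE lerN2 lez_nat.
    case: (eqVneq j l) => [->|/wE->//]; rewrite wl.
    exact: leq_trans (leq_pred _) (box_v l).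
  apply/existsP; exists l; apply/eqP/rowP=> j; rewrite !mxE eqxx /=.
  case: (eqVneq j l) => [->|/wE->] /=; last by rewrite subr0.
  by rewrite wl -{1}(prednK vl_gt0) -addn1 PoszD opprD.
apply: connect_trans (connect1 wv) (IH w _ _) => [|j].
  rewrite (bigD1 l) //= in lt_n; rewrite (bigD1 l) //= wl.
  rewrite (eq_bigr (fun j => v j : nat)) => [|j /wE->//].
  by rewrite -ltnS (leq_trans _ lt_n) // ltnS -addSn prednK.
case: (eqVneq j l) => [->|/wE->//]; rewrite wl.
exact: leq_trans (leq_pred _) (box_v l).
Qed.

(** A vertex with nonzero imbalance meets an edge; the source of that edge lies in the box of
    [box_connect], and its target is one step away. *)
Lemma imbalance_connect d v : imbalance d v != 0 -> connect adjacent v origin.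
Proof.
move=> b_n0; have [e /orP inc|no_edge] :=
  pickP (fun e : edge => (esrc e == v) || (etgt e == v)); last first.
  case/eqP: b_n0; rewrite /imbalance !big_pred0 ?subrr // => e;
    by have /negbT/norP[/negPf ? /negPf ?] := no_edge e.
have conn_src : connect adjacent (esrc e) origin.
  exact: box_connect (edge_src_le e).
case: inc => /eqP <- //; apply: connect_trans conn_src; apply: connect1.
by have := valP e; rewrite /adjacent /= /esrc /etgt -surjective_pairing => ->; rewrite orbT.
Qed.

Lemma card_edge : (#|{: edge}| <= #|V| ^ 2)%N.
Proof. by rewrite -mulnn -card_prod; apply: leq_card val_inj. Qed.

Lemma card_arc : (#|{: arc}| <= #|V| ^ 2)%N.
Proof. by rewrite -mulnn -card_prod; apply: leq_card val_inj. Qed.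

Lemma card_vertex_gt0 : (0 < #|V|)%N.
Proof. by apply/card_gt0P; exists origin. Qed.

(** By [inv_created], the backward arc of an arc carrying flow is available, so that [inv_cost]
    applies to both directions and forces cost 0. [inv_connect] supplies augmenting paths.
    [inv_count] is a budget: each iteration consumes at least 2 of the total absolute excess. *)
Record loop_inv d (i : nat) st : Prop := LoopInv {
  inv_balance : forall v,
    divergence (@asrc s N) (@atgt s N) (flow st) v + eps st v = imbalance d v;
  inv_ge0 : forall a, 0 <= flow st a;
  inv_created : forall a, 0 < flow st a -> created st a;
  inv_cost : forall e, available st e -> 0 <= reduced_cost (pot st) e;
  inv_connect : forall v, eps st v != 0 -> connect adjacent v origin;
  inv_count : 2 * i%:Z + \sum_v `|eps st v| <= \sum_v `|imbalance d v|
}.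

Lemma available_inr st a :
  available st (inr a) = created st a && (0 < flow st a).
Proof. by rewrite /available /=; case: ifP; rewrite ?ltxx //= => ->. Qed.

(** The divergence of the flow and the imbalance of [d] both sum to 0. *)
Lemma sum_eps d i st : loop_inv d i st -> \sum_v eps st v = 0.
Proof.
move=> inv; have := sum_divergence_eq0 (@esrc s N) (@etgt s N) d.
rewrite -[LHS](eq_bigr _ (fun v _ => inv_balance inv v)) big_split /=.
by rewrite sum_divergence_eq0 add0r.
Qed.

Lemma initialize_ok d :
  ensures (initialize d) (fun st k => loop_inv d 0 st /\ (k <= 5 * #|V| ^ 2)%N).
Proof.
apply: ensures_bind; apply: ensures_new_array.
pose I (pre : seq edge) (b : {ffun V -> int}) K := K = size pre /\
  forall v, b v = \sum_(e <- pre | esrc e == v) d e - \sum_(e <- pre | etgt e == v) d e.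
apply: ensures_bind; apply: (@ensures_weaken _ _ (I (enum edge))) => [b _ [-> def_b]|].
  apply: ensures_bind; apply: ensures_new_array.
  apply: ensures_bind; apply: ensures_new_array.
  apply: ensures_bind; apply: ensures_new_array.
  apply: ensures_ret; split; last first.
    (* Two arrays over the vertices, two over the arcs and one pass over the edges cost at most
       [2 n + 3 n^2]. *)
    have := card_arc; have := card_edge; have := card_vertex_gt0.
    rewrite -cardE -mulnn; move: #|V| #|edge| #|arc| => n m1 m2; nia.
  have eps_b v : b v = imbalance d v by rewrite def_b !big_enum_cond.
  split=> /= [v|a|a|e|v|].
  - rewrite eps_b /divergence !big1 ?subrr ?add0r // => a _; by rewrite ffunE.
  - by rewrite ffunE.
  - by rewrite ffunE ltxx.
  (* At potential 0 the forward arcs cost 1, and no backward arc exists yet. *)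
  - case: e => a /=; first by rewrite !ffunE.
    by rewrite /available /= !ffunE.
  - by rewrite eps_b; apply: imbalance_connect.
  - by rewrite mulr0 add0r; under eq_bigr do rewrite eps_b.
apply: ensures_foreach => [|pre e post b K _ [-> def_b]].
  by split=> // v; rewrite ffunE !big_nil subrr.
apply: ensures_bind; apply: ensures_spend; apply: ensures_ret.
split=> [|v]; first by rewrite size_rcons addn0 addn1.
rewrite -cats1 !big_cat /= !big_cons !big_nil !updE.
rewrite [esrc e == v]eq_sym [etgt e == v]eq_sym.
by case: (eqVneq v (etgt e)) => [->|_]; case: eqVneq => [->|_]; rewrite def_b; ring.
Qed.

(** * The inner loops: potential update, bottleneck and augmentation *)

Lemma update_pot_ok (delta : {ffun V -> option int}) (pi : {ffun V -> int}) :
  ensures (update_pot delta pi) (fun pi' k =>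
    (forall v, pi' v = pi v - odflt 0 (delta v)) /\ k = #|V|).
Proof.
pose I (pre : seq V) (pi' : {ffun V -> int}) K := K = size pre /\
  forall v, pi' v = if v \in pre then pi v - odflt 0 (delta v) else pi v.
apply: (@ensures_weaken _ _ (I (enum V))) => [pi' _ [-> def_pi']|].
  by split=> [v|]; rewrite ?def_pi' ?mem_enum // -cardE.
apply: ensures_foreach => // pre u post pi' K eq_enum [-> def_pi'].
(* Each vertex is visited once, so its entry still holds the old potential. *)
have u_notin : u \notin pre.
  have := enum_uniq V; rewrite eq_enum cat_uniq /= negb_or.
  by case/and3P=> _ /andP[].
apply: ensures_bind; apply: ensures_spend; apply: ensures_ret.
split=> [|v]; first by rewrite size_rcons addn0 addn1.
rewrite updE mem_rcons inE !def_pi' (negPf u_notin).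
by case: eqP => [->|].
Qed.

Lemma bottleneck_ok (f : {ffun arc -> int}) (p : seq rarc) g : 0 < g ->
  (forall a, inr a \in p -> 0 < f a) ->
  ensures (bottleneck f p g) (fun g' k =>
    [/\ 0 < g', g' <= g, forall a, inr a \in p -> g' <= f a & k = size p]).
Proof.
move=> g_gt0 f_gt0; pose I (pre : seq rarc) (g' : int) K :=
  [/\ 0 < g', g' <= g, forall a, inr a \in pre -> g' <= f a & K = size pre].
apply: (@ensures_foreach _ _ I) => // pre e post g' K def_p [g'_gt0 le_g' le_f ->].
apply: ensures_bind; apply: ensures_spend; apply: ensures_ret.
rewrite addn0 addn1 -(size_rcons _ e); case: e def_p => a def_p /=.
  by split=> // b; rewrite mem_rcons inE => /le_f.
have fa_gt0 : 0 < f a by apply: f_gt0; rewrite def_p mem_cat mem_head orbT.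
rewrite fa_gt0; split=> // [||b]; first by rewrite lt_min g'_gt0.
  by rewrite ge_min le_g'.
rewrite mem_rcons inE ge_min => /predU1P[[->]|/le_f->//].
by rewrite lexx orbT.
Qed.

(** As [p] repeats no residual arc, membership determines the net change of each entry; if both
    directions of an arc occur, they cancel. *)
Lemma augment_ok g (p : seq rarc) (f : {ffun arc -> int}) (c : {ffun arc -> bool}) :
  uniq p ->
  ensures (augment g p (f, c)) (fun fc k =>
    [/\ forall a, fc.1 a = f a + g * ((inl a \in p)%:R - (inr a \in p)%:R),
        forall a, fc.2 a = c a || (inl a \in p),
        forall v, divergence (@asrc s N) (@atgt s N) fc.1 v
          = divergence (@asrc s N) (@atgt s N) f v
            + g * \sum_(e <- p) ((rsrc e == v)%:R - (rtgt e == v)%:R)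
      & k = size p]).
Proof.
move=> uniq_p; pose I (pre : seq rarc) (fc : {ffun arc -> int} * {ffun arc -> bool}) K :=
  [/\ forall a, fc.1 a = f a + g * ((inl a \in pre)%:R - (inr a \in pre)%:R),
      forall a, fc.2 a = c a || (inl a \in pre),
      forall v, divergence (@asrc s N) (@atgt s N) fc.1 v
        = divergence (@asrc s N) (@atgt s N) f v
          + g * \sum_(e <- pre) ((rsrc e == v)%:R - (rtgt e == v)%:R)
    & K = size pre].
apply: (@ensures_foreach _ _ I) => [|pre e post fc K def_p [def_f def_c def_div ->]].
  by split=> // [a|a|v]; rewrite ?big_nil ?subrr ?mulr0 ?addr0 ?orbF.
have e_notin : e \notin pre.
  move: uniq_p; rewrite def_p cat_uniq /= negb_or.
  by case/and3P=> _ /andP[].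
apply: ensures_bind; apply: ensures_spend; apply: ensures_ret.
rewrite addn0 addn1 -(size_rcons _ e).
case: e {def_p} e_notin => a a_notin /=; split=> //=.
- move=> b; rewrite updE !mem_rcons !inE; case: eqP => [->|ne_ba].
    by rewrite def_f (negPf a_notin) eqxx /=; ring.
  by rewrite def_f; case: eqP => [[/ne_ba]|].
- move=> b; rewrite updE !mem_rcons !inE; case: eqP => [->|ne_ba].
    by rewrite eqxx orbT.
  by rewrite def_c; case: eqP => [[/ne_ba]|].
- by move=> v; rewrite divergence_upd def_div -cats1 big_cat big_seq1 /=; ring.
- move=> b; rewrite updE !mem_rcons !inE; case: eqP => [->|ne_ba].
    by rewrite def_f (negPf a_notin) eqxx /=; ring.
  by rewrite def_f; case: eqP => // _; case: eqP => [[/ne_ba]|].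
- by move=> b; rewrite def_c mem_rcons inE.
- by move=> v; rewrite divergence_upd def_div -cats1 big_cat big_seq1 /=; ring.
Qed.

Lemma reduced_cost_update (pi pi' delta : V -> int) (e : rarc) :
  (forall v, pi' v = pi v - delta v) ->
  reduced_cost pi' e = reduced_cost pi e + delta (rsrc e) - delta (rtgt e).
Proof. by move=> def_pi'; case: e => a /=; rewrite !def_pi'; ring. Qed.

(** * Effect of the distances on the reduced costs *)

Section Distances.
Variables (st : state s N) (vp : V) (delta : V -> option int).
Hypothesis delta_dist : forall v, is_distance (@rsrc s N) (@rtgt s N)
  (available st) (reduced_cost (pot st)) vp v (delta v).

(** For reachable ends this is the triangle inequality. The ends of [e] are both reachable or both
    not, since a forward arc leads back; if both are unreachable, the default 0 leaves only the
    nonnegativity of the cost. *)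
Lemma distance_arc e : available st e -> 0 <= reduced_cost (pot st) e ->
  odflt 0 (delta (rtgt e)) <= odflt 0 (delta (rsrc e)) + reduced_cost (pot st) e.
Proof.
move=> av_e cost_e; have [a [src_a tgt_a]] := reverse_rarc e.
have extend u f v p : walk (@rsrc s N) (@rtgt s N) (available st) u p (rsrc f) ->
    available st f -> rtgt f = v ->
    walk (@rsrc s N) (@rtgt s N) (available st) u (rcons p f) v.
  move=> walk_p av_f tgt_f; rewrite -cats1; apply: walk_cat walk_p _ => /=.
  by rewrite av_f eqxx tgt_f /=.
have := delta_dist (rsrc e); have := delta_dist (rtgt e).
case: (delta (rsrc e)) => [x|]; case: (delta (rtgt e)) => [y|] //=.
- case=> q [_ min_q] <- [p [walk_p _] <-].
  have := min_q _ (extend _ _ _ _ walk_p av_e erefl).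
  by rewrite /walk_len -cats1 big_cat big_seq1.
- move=> no_walk [p [walk_p _] _].
  by have := no_walk (rcons p e); rewrite (extend _ _ _ _ walk_p av_e erefl).
- case=> p [walk_p _] _ no_walk; have := no_walk (rcons p (inl a)).
  by rewrite (extend vp (inl a) _ p) //= src_a.
- by rewrite add0r.
Qed.

(** Replacing the part of [p] up to and including [e] by a shortest walk to [rtgt e] cannot shorten
    [p], so that part is itself shortest. Together with [distance_arc] this makes the arcs of [p]
    tight. *)
Lemma distance_shortest p vm e :
  shortest (@rsrc s N) (@rtgt s N) (available st) (reduced_cost (pot st)) vp p vm ->
  e \in p ->
  odflt 0 (delta (rsrc e)) + reduced_cost (pot st) e <= odflt 0 (delta (rtgt e)).
Proof.
move=> short_p e_p; case/splitPr: e_p short_p => p1 p2 [walk_p min_p].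
have [walk1 av_e walk2] := walk_split walk_p.
have walk1e : walk (@rsrc s N) (@rtgt s N) (available st) vp (rcons p1 e) (rtgt e).
  by rewrite -cats1; apply: walk_cat walk1 _; rewrite /= av_e !eqxx.
have := delta_dist (rsrc e); have := delta_dist (rtgt e).
case: (delta (rtgt e)) => [y|] /=; last by move/(_ (rcons p1 e)); rewrite walk1e.
case=> q [walk_q _] <-; case: (delta (rsrc e)) => [x|] /=; last first.
  by move/(_ p1); rewrite walk1.
case=> q' [_ min_q'] <-; have := min_q' _ walk1.
have := min_p _ (walk_cat walk_q walk2).
rewrite !walk_len_cat walk_len_cons addrA lerD2r => le_q le_p1.
by apply: le_trans le_q; rewrite lerD2r.
Qed.

End Distances.

(** * One iteration of the main loop *)

Lemma E_minus_neq0 d i st : loop_inv d i st -> E_plus st != set0 ->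
  E_minus st != set0.
Proof.
move=> inv /set0Pn[v]; rewrite inE => v_gt0; apply: contraTneq v_gt0 => no_neg.
have eps_ge0 w : 0 <= eps st w.
  by rewrite leNgt; have := in_set0 w; rewrite -no_neg inE => ->.
by rewrite -leNgt (psumr_eq0P _ (sum_eps inv)).
Qed.

Lemma iteration_ok d i st : loop_inv d i st -> E_plus st != set0 ->
  ensures (iteration st) (fun st' k =>
    loop_inv d i.+1 st' /\ (k <= 13 * #|V| ^ 2)%N).
Proof.
move=> inv plus_n0; have minus_n0 := E_minus_neq0 inv plus_n0.
apply: ensures_bind; apply: ensures_choose_in plus_n0 _ => vp; rewrite inE => vp_gt0.
apply: ensures_bind; apply: ensures_choose_in minus_n0 _ => vm; rewrite inE => vm_lt0.
have vp_vm : vp != vm by apply: contraTneq vp_gt0 => ->; rewrite -leNgt ltW.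
(* Both ends have nonzero excess, so each is connected to the origin. *)
have conn : connect adjacent vp vm.
  apply: connect_trans (_ : connect adjacent vp origin) _.
    by apply: inv_connect inv _ _; rewrite gt_eqF.
  by rewrite adjacent_connect_sym; apply: inv_connect inv _ _; rewrite lt_eqF.
apply: ensures_bind.
apply: ensures_weaken (dijkstra_ok (inv_cost inv) (connect_walk st conn)).
move=> [delta p] kd /= [delta_dist short_p uniq_p sz_p le_kd].
have walk_p := short_p.1.
have av_p e : e \in p -> available st e.
  move=> e_p; case/splitPr: e_p walk_p => p1 p2 /walk_split[//].
apply: ensures_bind; apply: ensures_weaken (update_pot_ok delta (pot st)).
move=> pi _ [def_pi ->].
apply: ensures_bind.
have g0_gt0 : 0 < Num.min (eps st vp) (- eps st vm).
  by rewrite lt_min vp_gt0 oppr_gt0.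
have inr_gt0 a : inr a \in p -> 0 < flow st a.
  by move/av_p; rewrite available_inr => /andP[].
apply: ensures_weaken (bottleneck_ok g0_gt0 inr_gt0) => g _ [g_gt0 le_g le_f ->].
move: le_g; rewrite le_min => /andP[le_gp le_gm].
apply: ensures_bind.
apply: ensures_weaken (augment_ok g (flow st) (created st) uniq_p).
move=> [f c] _ /= [def_f def_c def_div ->].
apply: ensures_bind; apply: ensures_spend; apply: ensures_ret.
have cost_e e : reduced_cost pi e = reduced_cost (pot st) e
    + odflt 0 (delta (rsrc e)) - odflt 0 (delta (rtgt e)).
  exact: (@reduced_cost_update (pot st) pi (fun v => odflt 0 (delta v))).
have cost_ge0 e : available st e -> 0 <= reduced_cost pi e.
  move=> av_e; rewrite cost_e subr_ge0 addrC.
  exact (distance_arc delta_dist av_e (inv_cost inv av_e)).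
(* This form matches [walk_telescope], so that the changes of divergence and excess cancel in the
   balance equation. *)
have eps_v v : upd (upd (eps st) vp (eps st vp - g)) vm
      (upd (eps st) vp (eps st vp - g) vm + g) v
    = eps st v - g * ((vp == v)%:R - (vm == v)%:R).
  rewrite !updE [vm == vp]eq_sym (negPf vp_vm) [vp == v]eq_sym [vm == v]eq_sym.
  case: eqP => [->|_]; first by rewrite eq_sym (negPf vp_vm) /=; ring.
  by case: eqP => [->|_] /=; ring.
(* Flow on an arc not augmented forwards was there before, so its backward arc was already available
   and its new cost is covered by [cost_ge0]. *)
have old_available a : 0 < f a -> inl a \notin p -> available st (inr a).
  rewrite def_f => f_gt0 /negPf a_notin; rewrite available_inr.
  have fa_gt0 : 0 < flow st a.
    by move: f_gt0; rewrite a_notin; case: (_ \in _) => /=; lia.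
  by rewrite (inv_created inv).
split; last first.
  (* Dijkstra takes at most [4 n + 3 n^2], with two residual arcs per arc; the remaining operations
     take at most [5 n + 1]. *)
  have := card_vertex_gt0; have := card_arc; move: le_kd sz_p.
  by rewrite card_sum -mulnn; move: #|V| #|arc| (size p) => n m l; nia.
split=> /= [v|a|a|e|v|].
- rewrite def_div (walk_telescope _ walk_p) eps_v -(inv_balance inv v); ring.
- rewrite def_f; have := inv_ge0 inv a; have := le_f a.
  by case: (inr a \in p); case: (inl a \in p) => /=; lia.
- move=> f_gt0; rewrite def_c; case: (boolP (inl a \in p)); rewrite ?orbT //.
  by move/(old_available a f_gt0); rewrite available_inr => /andP[->].
- case: e => a; last first.
    rewrite available_inr /= => /andP[_ f_gt0].
    case: (boolP (inl a \in p)) => [a_p|/(old_available a f_gt0) av_a].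
      (* [inl a] is tight, so its backward arc has reduced cost 0. *)
      have := distance_shortest delta_dist short_p a_p.
      by have := cost_e (inl a); rewrite /=; lia.
    exact: cost_ge0 av_a.
  by move=> _; apply: (cost_ge0 (inl a)).
(* No vertex gains a nonzero excess: only [vp] and [vm] change, and theirs were nonzero before. *)
- rewrite eps_v => eps'_n0; apply: (inv_connect inv); apply: contraNneq eps'_n0.
  move=> eps0; rewrite eps0; case: (eqVneq vp v) => [vp_v|_].
    by rewrite vp_v eps0 in vp_gt0.
  case: (eqVneq vm v) => [vm_v|_]; first by rewrite vm_v eps0 in vm_lt0.
  by rewrite subrr mulr0 subr0.
apply: le_trans (inv_count inv).
have sum1 (w : V) : \sum_v (w == v)%:R = 1 :> int.
  by rewrite (bigD1 w) //= eqxx big1 ?addr0 // => v; rewrite eq_sym => /negPf->.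
(* Both indicator sums equal 1. As [g] is a positive integer not exceeding either excess in absolute
   value, that value drops by at least 1 at [vp] and at [vm]. *)
suff : \sum_v `|eps st v - g * ((vp == v)%:R - (vm == v)%:R)|
    + \sum_v (vp == v)%:R + \sum_v (vm == v)%:R <= \sum_v `|eps st v|.
  rewrite !sum1; under [X in 2 * _ + X]eq_bigr do rewrite eps_v.
  by move: (\sum_v `|_ - _|) (\sum_v `|eps st v|) => x y; lia.
rewrite -!big_split /=; apply: ler_sum => v _.
case: (eqVneq vp v) vp_vm vp_gt0 le_gp => [->|_];
  case: (eqVneq vm v) vm_lt0 le_gm => [->|_] /=;
  by rewrite ?eqxx; move: (eps st v) => x; lia.
Qed.

End Residual.

(** * Operation counts and the state at exit *)

Section Termination.
Variables s N : nat.
Local Notation V := (vertex s N).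
Implicit Types (d : edge s N -> int) (st : state s N).

Lemma loop_test_ok st :
  ensures (loop_test st) (fun b k => b = (E_plus st != set0) /\ k = #|V|).
Proof.
by apply: ensures_bind; apply: ensures_spend; apply: ensures_ret; rewrite addn0.
Qed.

(** Initialization accounts for 5; an iteration, at most [13 n^2], and its loop test, [n], account
    for 14. *)
Lemma loop_head_inv d i st k : loop_head d i st k ->
  loop_inv d i st /\ (k <= (5 + 14 * i) * #|V| ^ 2)%N.
Proof.
elim=> [{}st {}k /(initialize_ok d).2[_ [<-]]|] //.
move=> {}i {}st {}k k1 st' k2 _ [inv le_k].
move=> /(loop_test_ok st).2[_ [<-] [/esym plus_n0 ->]].
move=> /(iteration_ok inv plus_n0).2[_ [<-] [inv' le_k2]]; split=> //.
by have := card_vertex_gt0 s N; move: le_k le_k2; rewrite -mulnn; nia.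
Qed.

(** At exit no excess is positive; as they sum to 0, all vanish. The final loop test raises the
    constant from 5 to 6. *)
Lemma finishes_inv d i st k : finishes d i st k ->
  [/\ loop_inv d i st, forall v, eps st v = 0
    & (k <= (6 + 14 * i) * #|V| ^ 2)%N].
Proof.
case=> k0 [k1 [/loop_head_inv[inv le_k0] /(loop_test_ok st).2[_ [<-]]]].
case=> /esym/negbFE/eqP no_pos -> ->.
have eps_le0 v : 0 <= - eps st v.
  by rewrite oppr_ge0 leNgt; have := in_set0 v; rewrite -no_pos inE => ->.
split=> // [v|].
  have sum0 : \sum_w - eps st w = 0 by rewrite sumrN (sum_eps inv) oppr0.
  by apply: oppr_inj; rewrite oppr0 (psumr_eq0P _ sum0).
by have := card_vertex_gt0 s N; move: le_k0; rewrite -mulnn; nia.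
Qed.

End Termination.

(** * Linear programming duality and optimality of the output *)

Section Optimality.
Variables (R : realFieldType) (s N : nat) (d : edge s N -> int).
Let dR (e : edge s N) : R := (d e)%:~R.

Lemma imbalance_intr v : imbalance dR v = (imbalance d v)%:~R.
Proof. exact: divergence_intr. Qed.

Lemma iteration_boundE :
  iteration_bound dR = 2^-1 * (\sum_v `|imbalance d v|)%:~R.
Proof.
rewrite /iteration_bound rmorph_sum; congr (_ * _); apply: eq_bigr => v _.
by rewrite imbalance_intr /= intr_norm.
Qed.

Lemma iterations_le i st : loop_inv d i st -> i%:R <= iteration_bound dR.
Proof.
move=> inv; rewrite iteration_boundE mulrC ler_pdivlMr // mulrC.
have : 2 * i%:Z <= \sum_v `|imbalance d v|.
  by apply: le_trans (inv_count inv); rewrite lerDl sumr_ge0.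
by rewrite -(ler_int R) rmorphM.
Qed.

Lemma dual_value_flow (f : Defs.arc s N -> R) (x : vertex s N -> R) :
  flow_feasible dR f ->
  dual_value dR x = \sum_a f a * (x (asrc a) - x (atgt a)).
Proof.
case=> balance _; rewrite -sum_divergence.
by apply: eq_bigr => v _; rewrite -balance.
Qed.

(** In [dual_value_flow], the factor of [f a] is at most 1 by the dual constraint of the reverse
    arc. *)
Lemma weak_duality (f : Defs.arc s N -> R) (x : vertex s N -> R) :
  flow_feasible dR f -> dual_feasible x -> dual_value dR x <= flow_cost f.
Proof.
move=> feas_f feas_x; rewrite (dual_value_flow x feas_f).
apply: ler_sum => a _; rewrite ler_piMr ?feas_f.2 //.
by have [b [<- <-]] := reverse_arc a.
Qed.

Lemma final_state_optimal i st : loop_inv d i st -> (forall v, eps st v = 0) ->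
  solves_flow dR (out_flow R st) /\ solves_dual dR (out_dual R st).
Proof.
move=> inv eps0.
have feas_f : flow_feasible dR (out_flow R st).
  split=> [v|a]; last by rewrite ler0z (inv_ge0 inv).
  rewrite imbalance_intr -(inv_balance inv) eps0 addr0.
  exact: divergence_intr.
have feas_x : dual_feasible (out_dual R st).
  (* The constraint for [a] is the nonnegative reduced cost of its reverse [b]. *)
  move=> a; have [b [src_b tgt_b]] := reverse_arc a.
  rewrite /out_dual -rmorphB -[1]/(1%:~R) ler_int -src_b -tgt_b.
  by have := inv_cost inv (isT : available st (inl b)); rewrite /=; lia.
have eq_value : dual_value dR (out_dual R st) = flow_cost (out_flow R st).
  rewrite (dual_value_flow _ feas_f); apply: eq_bigr => a _.
  rewrite /out_flow /out_dual -rmorphB -rmorphM; congr (_%:~R).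
  (* Complementary slackness: where flow is positive, [inl a] and [inr a] have opposite, nonnegative
     reduced costs, hence both 0. *)
  have := inv_ge0 inv a; rewrite le0r => /predU1P[->|f_gt0].
    by rewrite mul0r.
  have av_a : available st (inr a) by rewrite available_inr (inv_created inv).
  have := inv_cost inv av_a.
  have := inv_cost inv (isT : available st (inl a)); rewrite /= => ge0 le0.
  suff -> : pot st (asrc a) - pot st (atgt a) = 1 by rewrite mulr1.
  by move: (pot st (asrc a)) (pot st (atgt a)) ge0 le0 => x y; lia.
split; split=> //.
  by move=> g feas_g; rewrite -eq_value weak_duality.
by move=> y feas_y; rewrite eq_value weak_duality.
Qed.

End Optimality.

Theorem theorem13 :
  exists C : nat,
    (forall (V A : finType) (src tgt : A -> V) (avail : pred A)
            (len : A -> int) (r t : V),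
        injective (fun e => (src e, tgt e)) ->
        (forall e, avail e -> 0 <= len e) ->
        (exists p, walk src tgt avail r p t) ->
        ensures (dijkstra src tgt avail len r t)
          (fun res k =>
             [/\ forall v, is_distance src tgt avail len r v (res.1 v),
                 shortest src tgt avail len r res.2 t
               & (k <= C * #|V| ^ 2)%N]))
    /\
    (forall (R : realFieldType) (s N : nat) (d : edge s N -> int),
        let dR := fun e => (d e)%:~R : R in
        let n := #|{: vertex s N}| in
        let B := iteration_bound dR in
        [/\ safe (initialize d),
            forall i st k, loop_head d i st k ->
              i%:R <= B /\ (E_plus st != set0 -> safe (iteration st))
          & forall i st k, finishes d i st k ->
              [/\ solves_flow dR (out_flow R st),
                  solves_dual dR (out_dual R st)
                & k%:R <= C%:R * Num.max B 1 * n%:R ^+ 2]]).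
Proof.
(* The constant is [6 + 14], since [6 + 14 i <= 20 max(B, 1)]; it also exceeds what Dijkstra needs,
   [4 n + 2 n^2]. *)
exists 20%N; split=> [V A src tgt avail len r t inj len_ge0 reach|R s N d dR n B].
  apply: ensures_weaken (dijkstra_ok len_ge0 reach) => res k.
  case=> dist_ok short_ok _ _ le_k; split=> //.
  (* Without parallel arcs, an arc is determined by its pair of ends. *)
  have le_A : (#|A| <= #|V| ^ 2)%N by rewrite -mulnn -card_prod; apply: leq_card inj.
  have V_gt0 : (0 < #|V|)%N by apply/card_gt0P; exists r.
  by move: le_k le_A; rewrite -mulnn; nia.
split=> [|i st k /loop_head_inv[inv _]|i st k].
- by apply: ensures_weaken (initialize_ok d).
- split; first exact: iterations_le inv.
  by move=> /(iteration_ok inv); apply: ensures_weaken.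
case/finishes_inv=> inv eps0 le_k.
have [opt_f opt_x] := final_state_optimal R inv eps0; split=> //.
apply: le_trans (_ : ((6 + 14 * i) * n ^ 2)%:R <= _); first by rewrite ler_nat.
rewrite natrM natrX ler_wpM2r ?exprn_ge0 // natrD natrM.
have : i%:R <= Num.max B 1 by rewrite le_max (iterations_le R inv).
have : 1 <= Num.max B 1 by rewrite le_max lexx orbT.
lra.
Qed.
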